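(* Let $\mu$ be a $\sigma$-finite positive measure on a set $X$, let $m \ge 1$ be an integer, and let $D_1, \ldots, D_m$ be positive multiplication operators on the complex space $L^2(X,\mu)$ such that $D_1 \cdots D_m \ge I$. Then, for any positive bounded linear operator $A$ on $L^2(X,\mu)$, $$w(A)^m \le w(D_1 A) \, w(D_2 A) \cdots w(D_m A)$$ and $$w(A)^m \le w(A D_1) \, w(A D_2) \cdots w(A D_m).$$
   Context: $L^2(X,\mu)$ is the complex Hilbert space with inner product $\langle f, g\rangle = \int_X f \overline{g}\, d\mu$ and norm $\|\cdot\|_2$. The numerical radius of a bounded linear operator $A$ on $L^2(X,\mu)$ is $w(A) = \sup\{ |\langle A f, f\rangle| : f \in L^2(X,\mu),\ \|f\|_2 = 1\}$. An operator on $L^2(X,\mu)$ is called positive if it maps nonnegative functions to nonnegative functions (this is positivity in the order sense, not positive semidefiniteness); $A \ge B$ means that $A - B$ is positive in this sense. $I$ is the identity operator. A multiplication operator $D$ on $L^2(X,\mu)$ is an operator of the form $Df = d f$ for all $f \in L^2(X,\mu)$, where $d \in L^\infty(X,\mu)$ is a fixed function. *)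

(* Defs.v *)
From HB Require Import structures.
From mathcomp Require Import all_boot all_order all_algebra ring_quotient.
From mathcomp Require Import all_classical all_reals all_analysis.
From mathcomp Require Import measurable_realfun complex.

Set Implicit Arguments.
Unset Strict Implicit.
Unset Printing Implicit Defensive.
Import Order.TTheory GRing.Theory Num.Theory.
Import numFieldNormedType.Exports.

Local Open Scope classical_set_scope.
Local Open Scope ring_scope.
Local Open Scope quotient_scope.

Import Normc.

(* MathComp-Analysis puts no measurable structure on [R[i]]; the Borel
   sigma-algebra of [R[i]] is that of the plane. *)
Definition cmeasurable d (X : measurableType d) (R : realType)
    (f : X -> R[i]) : Prop :=
  measurable_fun setT (fun x => complex.Re (f x)) /\
  measurable_fun setT (fun x => complex.Im (f x)).

Definition cintegral d (X : measurableType d) (R : realType)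
    (mu : {measure set X -> \bar R}) (f : X -> R[i]) : R[i] :=
  Complex (\int[mu]_x complex.Re (f x)) (\int[mu]_x complex.Im (f x)).

Definition cLfun d (X : measurableType d) (R : realType)
    (mu : {measure set X -> \bar R}) (p : \bar R) : {pred X -> R[i]} :=
  mem [set f | cmeasurable f /\ finite_norm mu p (fun x => normc (f x))].

Section L2_space.
Context d (X : measurableType d) (R : realType).
Variable mu : {measure set X -> \bar R}.

Lemma normcE (z : R[i]) : (normc z)%:C%C = `|z|.
Proof. by case: z. Qed.

Lemma normc_ge0 (z : R[i]) : 0 <= normc z.
Proof. by case: z => a b; exact: sqrtr_ge0. Qed.

Lemma ler_normcD (z w : R[i]) : normc (z + w) <= normc z + normc w.
Proof. by rewrite -lecR rmorphD !normcE ler_normD. Qed.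

Lemma measurable_normc (f : X -> R[i]) :
  cmeasurable f -> measurable_fun setT (fun x => normc (f x)).
Proof.
move=> [mr mi].
rewrite (_ : (fun x => _) = (fun x => Num.sqrt
  (complex.Re (f x) ^+ 2 + complex.Im (f x) ^+ 2))); last first.
  by apply/funext => x; case: (f x).
rewrite -[X in measurable_fun _ X]/(Num.sqrt \o (fun x => complex.Re (f x) ^+ 2 + complex.Im (f x) ^+ 2)).
apply: measurableT_comp.
  by apply: continuous_measurable_fun; exact: sqrt_continuous.
by apply: measurable_funD; exact: measurable_funX.
Qed.

Lemma cmeasurableZ (a : R[i]) (f : X -> R[i]) :
  cmeasurable f -> cmeasurable (a *: f).
Proof.
move=> [mr mi]; case: a => a b; split.
- rewrite (_ : (fun x => _) =
    (fun x => a * complex.Re (f x) - b * complex.Im (f x))); last first.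
    by apply/funext => x; rewrite fctE; case: (f x).
  by apply: measurable_funB; exact: measurable_funM.
- rewrite (_ : (fun x => _) =
    (fun x => a * complex.Im (f x) + b * complex.Re (f x))); last first.
    by apply/funext => x; rewrite fctE; case: (f x).
  by apply: measurable_funD; exact: measurable_funM.
Qed.

Lemma cmeasurableD (f g : X -> R[i]) :
  cmeasurable f -> cmeasurable g -> cmeasurable (f + g).
Proof.
move=> [fr fi] [gr gi]; split.
- rewrite (_ : (fun x => _) =
    (fun x => complex.Re (f x) + complex.Re (g x))); last first.
    by apply/funext => x; rewrite fctE; case: (f x); case: (g x).
  exact: measurable_funD.
- rewrite (_ : (fun x => _) =
    (fun x => complex.Im (f x) + complex.Im (g x))); last first.
    by apply/funext => x; rewrite fctE; case: (f x); case: (g x).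
  exact: measurable_funD.
Qed.

Lemma cLfun2P (f : X -> R[i]) : (f \in cLfun mu 2%:E) <->
  cmeasurable f /\ (fun x => normc (f x)) \in Lfun mu 2%:E.
Proof.
split=> [/set_mem[mf ff]|[mf /andP[_ /set_mem ff]]]; last exact/mem_set.
by split => //; apply/andP; split; apply/mem_set => //; exact: measurable_normc.
Qed.

Lemma Lfun2_le (u v : X -> R) : measurable_fun setT u ->
  (forall x, 0 <= u x <= v x) -> v \in Lfun mu 2%:E -> u \in Lfun mu 2%:E.
Proof.
move=> mu0 uv /andP[/set_mem mv /set_mem fv].
apply/andP; split; apply/mem_set => //; rewrite /finite_norm/=.
apply: le_lt_trans fv; rewrite unlock /Lnorm.
have ge0 (w : X -> R) :
    (\int[mu]_x (`|(EFin \o w) x| `^ 2))%E \in `[0, +oo]%E.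
  by rewrite in_itv/= leey andbT; apply: integral_ge0 => x _; rewrite lee_fin powR_ge0.
apply: gt0_ler_poweR; rewrite ?invr_ge0//.
have mpow (w : X -> R) : measurable_fun setT w ->
    measurable_fun setT (fun x => `|(EFin \o w) x| `^ 2)%E.
  move=> mw; apply/measurable_EFinP.
  rewrite -[X in measurable_fun _ X]/((@powR R ^~ 2) \o (fun x => `|w x|)).
  by apply: measurableT_comp => //; exact: measurableT_comp.
apply: ge0_le_integral => //; [by move=> x _; rewrite lee_fin powR_ge0|exact: mpow|exact: mpow|].
move=> x _; have /andP[u0 ul] := uv x.
rewrite /= lee_fin !ger0_norm ?(le_trans u0)//.
by apply: ge0_ler_powR; rewrite // nnegrE// (le_trans u0).
Qed.

Lemma cLfun2_submod_closed : submod_closed (cLfun mu 2%:E).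
Proof.
have p1 : (1 <= 2%:E :> \bar R)%E by rewrite lee_fin ler1n.
split.
  apply/cLfun2P; split; first by split; exact: measurable_cst.
  rewrite (_ : (fun x => _) = cst 0); first exact: (LfunP (cst 0 : LfunType mu p1)).
  by apply/funext => x /=; exact: normc0.
move=> a f g /cLfun2P[mf Nf] /cLfun2P[mg Ng].
have maf : cmeasurable (a *: f) by exact: cmeasurableZ.
have mafg : cmeasurable (a *: f + g) by exact: cmeasurableD.
apply/cLfun2P; split => //.
apply: (@Lfun2_le _
  ((normc a *: (fun x => normc (f x)) : X -> R) + (fun x => normc (g x)))).
- exact: measurable_normc.
- move=> x; rewrite normc_ge0/=.
  have : normc (a * f x + g x) <= normc a * normc (f x) + normc (g x).
    by rewrite -normcM; exact: ler_normcD.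
  exact.
have [p0 pD] := Lfun_submod_closed mu p1.
exact: pD.
Qed.

HB.instance Definition _ := GRing.isSubmodClosed.Build _ _ (cLfun mu 2%:E)
  cLfun2_submod_closed.

Record L2fun := MkL2fun {
  L2fun_val :> X -> R[i];
  _ : L2fun_val \in cLfun mu 2%:E }.

HB.instance Definition _ := [isSub for L2fun_val].
HB.instance Definition _ := [Choice of L2fun by <:].
HB.instance Definition _ := [SubChoice_isSubLmodule of L2fun by <:].

Definition null_L2fun : {pred L2fun} :=
  mem [set f : L2fun | \forall x \ae mu, f x = 0].

Lemma null_L2fun_submod_closed : submod_closed null_L2fun.
Proof.
split; first by apply/mem_set; apply: nearW.
move=> a f g /set_mem f0 /set_mem g0; apply/mem_set.
by apply: filterS2 f0 g0 => x /= fx gx; rewrite !fctE fx gx scaler0 addr0.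
Qed.

HB.instance Definition _ := GRing.isSubmodClosed.Build _ _ null_L2fun
  null_L2fun_submod_closed.

(* Two square-integrable functions are identified when their difference
   vanishes almost everywhere. *)
Definition L2 : Type := Quotient.quot null_L2fun.

HB.instance Definition _ := GRing.Zmodule.on L2.
HB.instance Definition _ := EqQuotient.on L2.

Lemma L2_eqP (f g : L2fun) :
  reflect (\forall x \ae mu, f x = g x) (\pi_L2 f == \pi_L2 g).
Proof.
have eqE : (f - g \in null_L2fun) = (\pi_L2 f == \pi_L2 g).
  exact: (@Quotient.idealrBE _ null_L2fun f g).
rewrite -eqE; apply: (iffP idP) => [/set_mem|] fg; last apply/mem_set.
  by apply: filterS fg => x /eqP; rewrite subr_eq0 => /eqP.
by apply: filterS fg => x /= fgx; apply/eqP; rewrite subr_eq0 fgx.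
Qed.

Definition L2_scale (a : R[i]) (f : L2) : L2 := \pi_L2 (a *: repr f).

Lemma L2_reprK (f : L2fun) : \forall x \ae mu, repr (\pi_L2 f) x = f x.
Proof. by apply/L2_eqP; rewrite reprK. Qed.

Lemma pi_L2D (f g : L2fun) : \pi_L2 (f + g) = \pi_L2 f + \pi_L2 g.
Proof. by rewrite !piE. Qed.

Lemma pi_L2_scale a (f : L2fun) : \pi_L2 (a *: f) = L2_scale a (\pi_L2 f).
Proof.
apply/eqP/L2_eqP; apply: filterS (L2_reprK f) => x fx.
exact: (congr1 ( *%R a) (esym fx)).
Qed.

Lemma L2_scaleA a b (f : L2) : L2_scale a (L2_scale b f) = L2_scale (a * b) f.
Proof.
elim/quotW: f => f.
by rewrite -(pi_L2_scale b f) -(pi_L2_scale a) -(pi_L2_scale (a * b) f) scalerA.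
Qed.

Lemma L2_scale1 : left_id 1 L2_scale.
Proof. by elim/quotW => f; rewrite -(pi_L2_scale 1 f) scale1r. Qed.

Lemma L2_scaleDr : right_distributive L2_scale +%R.
Proof.
move=> a; elim/quotW => f; elim/quotW => g.
by rewrite -pi_L2D -!(pi_L2_scale a) scalerDr pi_L2D.
Qed.

Lemma L2_scaleDl f : {morph L2_scale^~ f : a b / a + b}.
Proof.
move=> a b; elim/quotW: f => f.
rewrite -(pi_L2_scale (a + b) f) -(pi_L2_scale a f) -(pi_L2_scale b f).
by rewrite scalerDl pi_L2D.
Qed.

HB.instance Definition _ := GRing.Zmodule_isLmodule.Build R[i] L2
  L2_scaleA L2_scale1 L2_scaleDr L2_scaleDl.

(* A representative; it is determined only up to a null set. *)
Definition L2_to_fun (f : L2) : X -> R[i] := repr f.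
Local Coercion L2_to_fun : L2 >-> Funclass.

Lemma L2_funD (f g : L2) : \forall x \ae mu, L2_to_fun (f + g) x = f x + g x.
Proof.
have -> : f + g = \pi_L2 (repr f + repr g) by rewrite pi_L2D !reprK.
exact: L2_reprK.
Qed.

Lemma L2_funZ a (f : L2) : \forall x \ae mu, L2_to_fun (a *: f) x = a * f x.
Proof. exact: L2_reprK. Qed.

End L2_space.

Coercion L2_to_fun : L2 >-> Funclass.

Section L2_operators.
Context d (X : measurableType d) (R : realType).
Variable mu : {measure set X -> \bar R}.
Implicit Types (f g : L2 mu) (A B D : L2 mu -> L2 mu).

Definition L2_inner f g : R[i] := cintegral mu (fun x => f x * ((g x)^*)%C).

Definition L2_norm f : R := fine 'N[mu]_2%:E[EFin \o (fun x => normc (f x))].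

Definition L2_bounded A : Prop :=
  exists M : R, forall f, L2_norm (A f) <= M * L2_norm f.

(* When [mu] is the zero measure there is no unit vector, and the value is
   [sup set0 = 0]. *)
Definition numerical_radius A : R :=
  sup [set normc (L2_inner (A f) f) | f in [set f | L2_norm f = 1]].

(* In the order of [R[i]], [0 <= z] means that [z] is real and nonnegative. *)
Definition L2_nonneg f : Prop := \forall x \ae mu, 0 <= f x.

Definition positive_operator A : Prop :=
  forall f, L2_nonneg f -> L2_nonneg (A f).

Definition operator_ge A B : Prop := positive_operator (A \- B).

Definition multiplication_operator D : Prop :=
  exists2 phi : X -> R[i], phi \in cLfun mu +oo%E &
    forall f, \forall x \ae mu, D f x = phi x * f x.

End L2_operators.

(* Main.v *)
Require Import Defs.
From mathcomp Require Import all_boot all_order all_algebra.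
From mathcomp Require Import all_classical all_reals all_analysis.
From mathcomp Require Import complex.
From mathcomp Require Import ring_quotient ess_sup_inf measurable_realfun.
From mathcomp Require Import ring lra.

(** Let [w] be the numerical radius. The proof turns the pointwise inequality
between arithmetic and geometric means into an inequality between operators,
takes numerical radii, and optimises the weights afterwards.

Write [D i] as multiplication by [phi i]. If [t i >= 0], [c >= 0] and
[c ^ m <= \prod_i t i], then wherever [phi i >= 0] and [\prod_i phi i >= 1] one
has [m c <= \sum_i t i * phi i]; hence [m c I <= \sum_i t i D i] in the order
sense ([multiplication_operator_weighted_sum]). Composing with the positive
operator [A] on either side gives
[m c A <= \sum_i t i (D i A)] and [m c A <= \sum_i t i (A D i)].

The numerical radius of a positive operator [B] may be computed on nonnegative
functions: [|B f| <= B |f|] ([positive_operator_abs]), so that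
[|<B f, f>| <= <B |f|, |f|>] ([normc_L2_inner_positive]), where [|f|] has the
same norm as [f]. On nonnegative functions the operator inequalities can be
paired with the function itself, and they yield
[m c w(A) <= \sum_i t i w(D i A)], and likewise for [A D i]
([numerical_radius_weighted_le]).

Finally the choice [t i = 1 / w(D i A)], with [c] the [m]-th root of
[\prod_i t i], gives [c w(A) <= 1], that is,
[w(A) ^ m <= \prod_i w(D i A)] ([prod_bound_of_weighted_sums]). This route
avoids integral kernels and adjoints: the two inequalities have the same
proof. *)

Set Implicit Arguments.
Unset Strict Implicit.
Unset Printing Implicit Defensive.
Import Order.TTheory GRing.Theory Num.Theory.

Local Open Scope ring_scope.
Local Open Scope quotient_scope.
Local Notation normc := Normc.normc.

(** * Weighted arithmetic and geometric means *)

(** Over an abstract number field, so that it applies to the complex values of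
the multipliers, whose nonnegativity means being real and nonnegative. *)
Lemma weighted_AGM (F : numFieldType) (m : nat) (t e : 'I_m -> F) (c : F) :
  (0 < m)%N -> (forall i, 0 <= t i) -> (forall i, 0 <= e i) -> 0 <= c ->
  c ^+ m <= \prod_i t i -> 1 <= \prod_i e i ->
  m%:R * c <= \sum_i t i * e i.
Proof.
move=> m0 t0 e0 c0 ct e1.
have te0 i : 0 <= t i * e i by rewrite mulr_ge0.
have := @leif_AGM _ 'I_m predT (fun i => t i * e i) (fun i _ => te0 i).
rewrite cardT size_enum_ord => -[agm _].
have mu0 : 0 <= (\sum_i t i * e i) / m%:R by rewrite divr_ge0 ?sumr_ge0.
have: c ^+ m <= ((\sum_i t i * e i) / m%:R) ^+ m.
  apply: le_trans ct (le_trans _ agm).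
  by rewrite big_split ler_peMr// prodr_ge0.
by rewrite ler_pXn2r// ler_pdivlMr ?ltr0n// mulrC.
Qed.

(** The converse of the weighted mean inequality: a bound that holds for all
admissible weights already contains the bound by the product. When every [w i] is
positive, the optimal weights are [1 / w i], which equalise the summands. When
some [w j] vanishes, the weight [t j] is free, and letting it grow forces
[a = 0]. *)
Lemma prod_bound_of_weighted_sums (R : realType) (m : nat)
    (w : 'I_m -> R) (a : R) :
  (0 < m)%N -> 0 <= a -> (forall i, 0 <= w i) ->
  (forall (t : 'I_m -> R) c, (forall i, 0 <= t i) -> 0 <= c ->
     c ^+ m <= \prod_i t i -> m%:R * c * a <= \sum_i t i * w i) ->
  a ^+ m <= \prod_i w i.
Proof.
move=> m0 a0 w0 H; have m0' : 0 < m%:R :> R by rewrite ltr0n.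
have [wpos|] := boolP [forall i, 0 < w i].
  have {}wpos i : 0 < w i by move/forallP: wpos => /(_ i).
  have W0 : 0 < \prod_i w i by rewrite prodr_gt0.
  pose c := (\prod_i (w i)^-1) `^ (m%:R^-1).
  have Wi : \prod_i (w i)^-1 = (\prod_i w i)^-1 by rewrite prodfV.
  have c0 : 0 <= c by exact: powR_ge0.
  have cm : c ^+ m = (\prod_i w i)^-1.
    rewrite -powR_mulrn// /c -powRrM mulVf ?gt_eqF//.
    by rewrite powRr1 Wi// invr_ge0 ltW.
  have sum1 : \sum_i (w i)^-1 * w i = m%:R.
    under eq_bigr do rewrite mulVf ?gt_eqF//.
    by rewrite sumr_const card_ord.
  have := H (fun i => (w i)^-1) c.
  rewrite sum1 cm Wi lexx => /(_ _ c0 isT).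
  rewrite -mulrA ger_pMr// => ca1.
  have {}ca1 : c * a <= 1 by apply: ca1 => i; rewrite invr_ge0 ltW.
  have : (c * a) ^+ m <= 1 by rewrite exprn_ile1// mulr_ge0.
  by rewrite exprMn cm ler_pdivrMl// mulr1.
rewrite negb_forall => /existsP[j]; rewrite -leNgt => wj.
have {}wj : w j = 0 by apply/eqP; rewrite eq_le wj w0.
have -> : \prod_i w i = 0 by rewrite (bigD1 j)//= wj mul0r.
have [->|a1] := eqVneq a 0; first by rewrite expr0n gtn_eqF.
have {a1}a0 : 0 < a by rewrite lt_def a1.
(* The weight of the vanishing factor can be as large as needed. *)
pose S := \sum_i w i; have S0 : 0 <= S by exact: sumr_ge0.
pose c := (S + 1) / (m%:R * a).
have c0 : 0 <= c by rewrite divr_ge0 ?mulr_ge0 ?addr_ge0// ltW.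
have := H (fun i => if i == j then c ^+ m else 1) c.
rewrite (bigD1 j)//= eqxx big1 ?mulr1 => [|i /negbTE->//].
rewrite (bigD1 j)//= eqxx wj mulr0 add0r => /(_ _ c0 (lexx _)).
have -> : m%:R * c * a = S + 1 by rewrite /c; field; rewrite !gt_eqF.
move=> K.
suff : S + 1 <= S by rewrite gerDl ler10.
apply: le_trans (K _) _ => [i|]; first by case: ifP; rewrite ?exprn_ge0.
rewrite /S [leRHS](bigD1 j)//= wj add0r; apply: ler_sum => i /negbTE->.
by rewrite mul1r.
Qed.

(** * Complex numbers and complex integrals *)

Section complex_numbers.
Variable R : realType.
Implicit Types z w : R[i].

Lemma sqr_normc z : normc z ^+ 2 = complex.Re z ^+ 2 + complex.Im z ^+ 2.
Proof. by case: z => a b; rewrite /= sqr_sqrtr// addr_ge0 ?sqr_ge0. Qed.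

Lemma Re_le_normc z : `|complex.Re z| <= normc z.
Proof.
rewrite -(@ler_pXn2r _ 2) ?nnegrE ?normc_ge0// sqr_normc real_normK ?num_real//.
by rewrite lerDl sqr_ge0.
Qed.

Lemma Im_le_normc z : `|complex.Im z| <= normc z.
Proof.
rewrite -(@ler_pXn2r _ 2) ?nnegrE ?normc_ge0// sqr_normc real_normK ?num_real//.
by rewrite lerDr sqr_ge0.
Qed.

Lemma normc_conj z : normc z^*%C = normc z.
Proof. by case: z => a b /=; rewrite sqrrN. Qed.

Lemma normc_real (a : R) : normc a%:C%C = `|a|.
Proof. by rewrite /= expr0n addr0 sqrtr_sqr. Qed.

Lemma normc_nneg z : 0 <= z -> (normc z)%:C%C = z.
Proof. by move=> z0; rewrite Defs.normcE ger0_norm. Qed.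

End complex_numbers.

Section complex_integral.
Context d (X : measurableType d) (R : realType).
Variable mu : {measure set X -> \bar R}.
Implicit Types F G : X -> R[i].

Definition cintegrable F :=
  mu.-integrable setT (EFin \o (fun x => complex.Re (F x))) /\
  mu.-integrable setT (EFin \o (fun x => complex.Im (F x))).

(** Elements of [L2] are known only through representatives, so
pointwise identities between them hold almost everywhere, and integrals must be
compared up to null sets. *)
Lemma ae_eq_Rintegral (f g : X -> R) :
  measurable_fun setT f -> measurable_fun setT g ->
  (\forall x \ae mu, f x = g x) -> \int[mu]_x f x = \int[mu]_x g x.
Proof.
move=> mf mg fg; congr fine; apply: ae_eq_integral => //.
- exact/measurable_EFinP.
- exact/measurable_EFinP.
- by apply: filterS fg => x /= ->.
Qed.

Lemma cintegrable_measurable F : cintegrable F -> cmeasurable F.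
Proof.
move=> [/integrableP[/measurable_EFinP ? _] /integrableP[/measurable_EFinP ? _]].
by split.
Qed.

Lemma cintegrable_dominated F (g : X -> R) : cmeasurable F ->
  mu.-integrable setT (EFin \o g) -> (forall x, normc (F x) <= g x) ->
  cintegrable F.
Proof.
move=> [mr mi] ig Fg; split; apply: le_integrable ig => //.
- exact/measurable_EFinP.
- move=> x _ /=; rewrite lee_fin.
  exact: le_trans (Re_le_normc _) (le_trans (Fg x) (ler_norm _)).
- exact/measurable_EFinP.
- move=> x _ /=; rewrite lee_fin.
  exact: le_trans (Im_le_normc _) (le_trans (Fg x) (ler_norm _)).
Qed.

Lemma eq_cintegral F G : cmeasurable F -> cmeasurable G ->
  (\forall x \ae mu, F x = G x) -> cintegral mu F = cintegral mu G.
Proof.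
move=> [Fr Fi] [Gr Gi] FG.
by congr Complex; apply: ae_eq_Rintegral => //; apply: filterS FG => x /= ->.
Qed.

Lemma cintegralD F G : cintegrable F -> cintegrable G ->
  cintegral mu (fun x => F x + G x) = cintegral mu F + cintegral mu G.
Proof.
move=> [Fr Fi] [Gr Gi]; apply/eqP; rewrite eq_complex/= -!RintegralD//.
by apply/andP; split; apply/eqP; apply: eq_Rintegral => x _;
  case: (F x); case: (G x).
Qed.

Lemma cintegralZ a F : cintegrable F ->
  cintegral mu (fun x => a * F x) = a * cintegral mu F.
Proof.
case: a => a b [Fr Fi]; apply/eqP; rewrite eq_complex/=.
have iZ c (f : X -> R) : mu.-integrable setT (EFin \o f) ->
  mu.-integrable setT (EFin \o (fun x => c * f x)).
  by move=> fi; have := integrableZl measurableT c fi.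
rewrite -!RintegralZl// -RintegralB; [|by []|exact: iZ..].
rewrite -RintegralD; [|by []|exact: iZ..].
by apply/andP; split; apply/eqP; apply: eq_Rintegral => x _; case: (F x).
Qed.

Lemma cintegral_ge0 F : cmeasurable F -> (\forall x \ae mu, 0 <= F x) ->
  0 <= cintegral mu F.
Proof.
move=> mF F0.
have mG : cmeasurable (fun x => (normc (F x))%:C%C).
  by split => /=; [exact: measurable_normc|exact: measurable_cst].
rewrite (eq_cintegral mF mG); last first.
  by apply: filterS F0 => x /normc_nneg ->.
rewrite lecE/= Rintegral_ge0 => [|x _]; last exact: normc_ge0.
by rewrite Rintegral_cst// mul0r eqxx.
Qed.

(** Rotating the integral onto the positive real axis turns the modulus into
a real part, which is integrated pointwise. *)
Lemma normc_cintegral_le F : cintegrable F ->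
  mu.-integrable setT (EFin \o (fun x => normc (F x))) ->
  normc (cintegral mu F) <= \int[mu]_x normc (F x).
Proof.
move=> iF inF; move zE : (cintegral mu F) => z.
have [z0|z0] := eqVneq (normc z) 0.
  by rewrite z0 Rintegral_ge0// => x _; exact: normc_ge0.
have {}z0 : 0 < normc z by rewrite lt_def z0 normc_ge0.
rewrite -(ler_pM2l z0) -expr2 -RintegralZl//.
have -> : normc z ^+ 2 = complex.Re (z^*%C * z).
  by rewrite sqr_normc; case: (z) => a b /=; ring.
rewrite -[X in complex.Re (_ * X)]zE -cintegralZ//=; apply: le_Rintegral => //.
- have [ir _] : cintegrable (fun x => z^*%C * F x); last exact: ir.
  apply: (@cintegrable_dominated _ (fun x => normc z * normc (F x))).
  + exact: (@cmeasurableZ _ _ _ z^*%C F (cintegrable_measurable iF)).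
  + by have := integrableZl measurableT (normc z) inF.
  + by move=> x; rewrite Normc.normcM normc_conj.
- by have := integrableZl measurableT (normc z) inF.
- move=> x _; apply: le_trans (ler_norm _) (le_trans (Re_le_normc _) _).
  by rewrite Normc.normcM normc_conj.
Qed.

End complex_integral.

(** * Elements of the Hilbert space and their inner product *)

Section L2_elements.
Context d (X : measurableType d) (R : realType).
Variable mu : {measure set X -> \bar R}.
Implicit Types (f g h : L2 mu).

Lemma L2_cLfun f : (f : X -> R[i]) \in cLfun mu 2%:E.
Proof. by rewrite /L2_to_fun; case: (repr f). Qed.

Lemma L2_cmeasurable f : cmeasurable f.
Proof. by have /cLfun2P[] := L2_cLfun f. Qed.

Lemma L2_normc_Lfun f : (fun x => normc (f x)) \in Lfun mu 2%:E.
Proof. by have /cLfun2P[] := L2_cLfun f. Qed.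

(** The way in which new elements of the Hilbert space are built: the modulus, the
real part and the imaginary part of [f] are all dominated by [f]. *)
Lemma L2_dominated (F : X -> R[i]) g : cmeasurable F ->
  (forall x, normc (F x) <= normc (g x)) ->
  exists f : L2 mu, \forall x \ae mu, f x = F x.
Proof.
move=> mF Fg.
have FL : F \in cLfun mu 2%:E.
  apply/cLfun2P; split => //; apply: Lfun2_le (L2_normc_Lfun g) => [|x].
    exact: measurable_normc.
  by rewrite normc_ge0 Fg.
by exists (\pi_(L2 mu) (MkL2fun FL)); exact: L2_reprK.
Qed.

Lemma L2_abs_exists f :
  exists h : L2 mu, \forall x \ae mu, h x = (normc (f x))%:C%C.
Proof.
apply: (@L2_dominated _ f) => [|x].
  by split => /=; [exact/measurable_normc/L2_cmeasurable|exact: measurable_cst].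
by rewrite normc_real ger0_norm ?normc_ge0.
Qed.

Lemma L2_Re_exists f :
  exists h : L2 mu, \forall x \ae mu, h x = (complex.Re (f x))%:C%C.
Proof.
have [mr _] := L2_cmeasurable f.
apply: (@L2_dominated _ f) => [|x]; first by split => //=.
by rewrite normc_real Re_le_normc.
Qed.

Lemma L2_Im_exists f :
  exists h : L2 mu, \forall x \ae mu, h x = (complex.Im (f x))%:C%C.
Proof.
have [_ mi] := L2_cmeasurable f.
apply: (@L2_dominated _ f) => [|x]; first by split => //=.
by rewrite normc_real Im_le_normc.
Qed.

Lemma L2_ext f g : (\forall x \ae mu, f x = g x) -> f = g.
Proof. by move=> fg; rewrite -[f]reprK -[g]reprK; apply/eqP/L2_eqP. Qed.

Lemma L2_funB f g : \forall x \ae mu, (f - g : L2 mu) x = f x - g x.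
Proof.
have := L2_funD f (- g); have := L2_funD (- g) g; rewrite addNr.
have := L2_funZ 0 (0 : L2 mu); rewrite scale0r.
apply: filterS3 => x -> + ->; rewrite mul0r => /esym/eqP.
by rewrite addr_eq0 => /eqP ->.
Qed.

Lemma L2_fun_sum n (F : 'I_n -> L2 mu) :
  \forall x \ae mu, (\sum_i F i : L2 mu) x = \sum_i F i x.
Proof.
elim: n F => [|n IH] F.
  rewrite big_ord0; have := L2_funZ 0 (0 : L2 mu); rewrite scale0r.
  by apply: filterS => x ->; rewrite mul0r big_ord0.
rewrite big_ord_recl.
apply: filterS2 (L2_funD (F ord0) (\sum_(i < n) F (lift ord0 i)))
  (IH (fun i => F (lift ord0 i)))
  => x -> ->.
by rewrite big_ord_recl.
Qed.

End L2_elements.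

Section L2_inner_product.
Context d (X : measurableType d) (R : realType).
Variable mu : {measure set X -> \bar R}.
Implicit Types (f g h : L2 mu).

Lemma cmeasurable_mul_conj (F G : X -> R[i]) : cmeasurable F -> cmeasurable G ->
  cmeasurable (fun x => F x * (G x)^*%C).
Proof.
move=> [Fr Fi] [Gr Gi]; split.
- rewrite (_ : (fun x => _) = (fun x => complex.Re (F x) * complex.Re (G x) +
      complex.Im (F x) * complex.Im (G x))); last first.
    by apply/funext => x; case: (F x) => a b; case: (G x) => a' b' /=; ring.
  by apply: measurable_funD; exact: measurable_funM.
- rewrite (_ : (fun x => _) = (fun x => complex.Im (F x) * complex.Re (G x) -
      complex.Re (F x) * complex.Im (G x))); last first.
    by apply/funext => x; case: (F x) => a b; case: (G x) => a' b' /=; ring.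
  by apply: measurable_funB; exact: measurable_funM.
Qed.

Lemma normc_mul_conj (z w : R[i]) :
  normc (z * w^*%C) = normc z * normc w.
Proof. by rewrite Normc.normcM normc_conj. Qed.

(** The Hoelder inequality enters here only, to make inner products converge. *)
Lemma integrable_normc_mul f g :
  mu.-integrable setT (EFin \o (fun x => normc (f x) * normc (g x))).
Proof.
apply/Lfun1_integrable.
exact: (Lfun2_mul_Lfun1 (L2_normc_Lfun f) (L2_normc_Lfun g)).
Qed.

Lemma cintegrable_inner f g : cintegrable mu (fun x => f x * (g x)^*%C).
Proof.
apply: (cintegrable_dominated _ (integrable_normc_mul f g)).
  exact: cmeasurable_mul_conj (L2_cmeasurable _) (L2_cmeasurable _).
by move=> x; rewrite normc_mul_conj.
Qed.

Lemma L2_innerD f g h : L2_inner (f + g) h = L2_inner f h + L2_inner g h.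
Proof.
rewrite -cintegralD; [|exact: cintegrable_inner..].
apply: eq_cintegral.
- exact/cintegrable_measurable/cintegrable_inner.
- apply: (@cmeasurableD _ _ _ (fun x => f x * (h x)^*%C) (fun x => g x * (h x)^*%C));
    exact/cintegrable_measurable/cintegrable_inner.
- by apply: filterS (L2_funD f g) => x ->; rewrite mulrDl.
Qed.

Lemma L2_innerZ a f h : L2_inner (a *: f) h = a * L2_inner f h.
Proof.
rewrite -cintegralZ; last exact: cintegrable_inner.
apply: eq_cintegral.
- exact/cintegrable_measurable/cintegrable_inner.
- apply: (@cmeasurableZ _ _ _ a (fun x => f x * (h x)^*%C));
    exact/cintegrable_measurable/cintegrable_inner.
- by apply: filterS (L2_funZ a f) => x ->; rewrite mulrA.
Qed.

Lemma L2_innerB f g h : L2_inner (f - g) h = L2_inner f h - L2_inner g h.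
Proof. by rewrite -scaleN1r L2_innerD L2_innerZ mulN1r. Qed.

Lemma L2_inner_sum n (F : 'I_n -> L2 mu) h :
  L2_inner (\sum_i F i) h = \sum_i L2_inner (F i) h.
Proof.
elim/big_rec2: _ => [|i y z _ <-]; last by rewrite L2_innerD.
by rewrite -(scale0r (0 : L2 mu)) L2_innerZ mul0r.
Qed.

Lemma L2_inner_ge0 f g : L2_nonneg f -> L2_nonneg g -> 0 <= L2_inner f g.
Proof.
move=> f0 g0; apply: cintegral_ge0.
  exact/cintegrable_measurable/cintegrable_inner.
apply: filterS2 f0 g0 => x fx gx; rewrite -(normc_nneg gx).
by rewrite conjc_real mulr_ge0// ler0c normc_ge0.
Qed.

Lemma normc_L2_inner_le f g :
  normc (L2_inner f g) <= \int[mu]_x (normc (f x) * normc (g x)).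
Proof.
have ifg : mu.-integrable setT
    (EFin \o (fun x => normc (f x * (g x)^*%C))).
  rewrite (_ : (fun x => _) = fun x => normc (f x) * normc (g x)).
    exact: integrable_normc_mul.
  by apply/funext => x; rewrite normc_mul_conj.
apply: le_trans (normc_cintegral_le (cintegrable_inner f g) ifg) _.
rewrite le_eqVlt; apply/orP; left; apply/eqP.
by apply: eq_Rintegral => x _; rewrite normc_mul_conj.
Qed.

(** Stated in [R[i]], where the inequality also says that the right-hand side is
real. *)
Lemma normc_L2_inner_le_abs f g (f' g' : L2 mu) :
  (\forall x \ae mu, f' x = (normc (f x))%:C%C) ->
  (\forall x \ae mu, g' x = (normc (g x))%:C%C) ->
  (normc (L2_inner f g))%:C%C <= L2_inner f' g'.
Proof.
move=> ff' gg'.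
have mfg := cmeasurable_mul_conj (L2_cmeasurable f) (L2_cmeasurable g).
have -> : L2_inner f' g' =
    cintegral mu (fun x => (normc (f x * (g x)^*%C))%:C%C).
  apply: eq_cintegral.
  - exact/cintegrable_measurable/cintegrable_inner.
  - by split; [exact: measurable_normc|exact: measurable_cst].
  - apply: filterS2 ff' gg' => x -> ->.
    by rewrite conjc_real normc_mul_conj rmorphM.
rewrite lecE/=; apply/andP; split.
  by rewrite Rintegral_cst// mul0r.
apply: le_trans (normc_L2_inner_le f g) _.
rewrite le_eqVlt; apply/orP; left; apply/eqP.
by apply: eq_Rintegral => x _; rewrite normc_mul_conj.
Qed.

Lemma L2_normE f : L2_norm f = Num.sqrt (\int[mu]_x normc (f x) ^+ 2).
Proof.
rewrite /L2_norm unlock fine_poweR powR12_sqrt; last first.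
  by rewrite fine_ge0// integral_ge0// => x _; rewrite lee_fin powR_ge0.
congr Num.sqrt; congr fine; apply: eq_integral => x _ /=.
by rewrite ger0_norm ?normc_ge0// powR_mulrn// normc_ge0.
Qed.

Lemma L2_norm_ge0 f : 0 <= L2_norm f.
Proof. by rewrite L2_normE sqrtr_ge0. Qed.

Lemma integrable_sqr_normc f :
  mu.-integrable setT (EFin \o (fun x => normc (f x) ^+ 2)).
Proof. exact: Lfun2_integrable_sqr (L2_normc_Lfun f). Qed.

Lemma L2_norm_sqr f : L2_norm f ^+ 2 = \int[mu]_x normc (f x) ^+ 2.
Proof. by rewrite L2_normE sqr_sqrtr// Rintegral_ge0// => x _; rewrite sqr_ge0. Qed.

Lemma L2_norm_le_ae (k : R) f g : 0 <= k ->
  (\forall x \ae mu, normc (f x) <= k * normc (g x)) ->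
  L2_norm f <= k * L2_norm g.
Proof.
move=> k0 fg.
rewrite -(@ler_pXn2r _ 2) ?nnegrE ?mulr_ge0 ?L2_norm_ge0// exprMn !L2_norm_sqr.
rewrite -RintegralZl//; last exact: integrable_sqr_normc.
have ikg : mu.-integrable setT (EFin \o (fun x => k ^+ 2 * normc (g x) ^+ 2)).
  by have := integrableZl measurableT (k ^+ 2) (integrable_sqr_normc g).
rewrite /Rintegral fine_le//.
- exact: (integrable_fin_num _ (integrable_sqr_normc f)).
- exact: (integrable_fin_num _ ikg).
apply: ae_ge0_le_integral => //.
- by move=> x _; rewrite lee_fin sqr_ge0.
- exact: measurable_int (integrable_sqr_normc f).
- by move=> x _; rewrite lee_fin mulr_ge0 ?sqr_ge0.
- exact: measurable_int ikg.
- apply: filterS fg => x fgx _; rewrite lee_fin -exprMn.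
  by rewrite ler_pXn2r ?nnegrE ?mulr_ge0 ?normc_ge0.
Qed.

(** A weak form of the Cauchy-Schwarz inequality, obtained by integrating
[2 a b <= a ^ 2 + b ^ 2]. On unit vectors it still bounds the values that define
a numerical radius. *)
Lemma normc_L2_inner_bound f g :
  normc (L2_inner f g) <= 2^-1 * (L2_norm f ^+ 2 + L2_norm g ^+ 2).
Proof.
apply: le_trans (normc_L2_inner_le f g) _.
rewrite !L2_norm_sqr -RintegralD//; [|exact: integrable_sqr_normc..].
have iD : mu.-integrable setT
    (EFin \o (fun x => normc (f x) ^+ 2 + normc (g x) ^+ 2)).
  by have := integrableD measurableT (integrable_sqr_normc f) (integrable_sqr_normc g).
rewrite -RintegralZl//; apply: le_Rintegral => //.
- exact: integrable_normc_mul.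
- by have := integrableZl measurableT 2^-1 iD.
- move=> x _; set a := normc _; set b := normc _.
  by have := sqr_ge0 (a - b); lra.
Qed.

End L2_inner_product.

(** * Positive operators and the modulus *)

(** The modulus of [z] is the supremum of [Re (q^* z) / |q|], and by continuity
rational [q] suffice. Countably many conditions are needed because each of them
will hold only almost everywhere. *)
Lemma normc_le_of_rational (R : realType) (z : R[i]) (k : R) : 0 <= k ->
  (forall p q : rat, ratr p * complex.Re z + ratr q * complex.Im z <=
     normc (Complex (ratr p) (ratr q)) * k) ->
  normc z <= k.
Proof.
move=> k0 H; rewrite leNgt; apply/negP => kr.
have := Re_le_normc z; have := Im_le_normc z.
set r := normc z in kr * => Imr Rer.
have r0 : 0 < r by exact: le_lt_trans kr.
(* Approximating [z] within [e] in both coordinates gives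
   [r ^ 2 - 2 e r <= (r + 2 e) k], and this value of [e] contradicts it. *)
pose e := r * (r - k) / (4 * (r + k)).
have rk0 : 0 < r + k by lra.
have e0 : 0 < e by rewrite divr_gt0 ?mulr_gt0 ?subr_gt0.
have eE : e * (4 * (r + k)) = r * (r - k).
  by rewrite /e divfK// mulf_neq0// gt_eqF.
have near (x : R) : exists p : rat, `|ratr p - x| <= e.
  have [|p] := @rat_in_itvoo _ (x - e) (x + e); first lra.
  by rewrite in_itv/= => /andP[? ?]; exists p; rewrite ler_norml; lra.
have [p pu] := near (complex.Re z); have [q qv] := near (complex.Im z).
have := H p q.
set a := ratr p - complex.Re z in pu; set b := ratr q - complex.Im z in qv.
have -> : ratr p = complex.Re z + a by rewrite /a; ring.
have -> : ratr q = complex.Im z + b by rewrite /b; ring.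
have zE : r ^+ 2 = complex.Re z ^+ 2 + complex.Im z ^+ 2 by exact: sqr_normc.
have nab : normc (Complex (complex.Re z + a) (complex.Im z + b)) <= r + 2 * e.
  have -> : Complex (complex.Re z + a) (complex.Im z + b) =
      z + (a%:C%C + Complex 0 1 * b%:C%C).
    case: (z) => z1 z2 /=; apply/eqP; rewrite eq_complex/=.
    by apply/andP; split; apply/eqP; ring.
  apply: le_trans (ler_normcD _ _) _; rewrite lerD2l.
  apply: le_trans (ler_normcD _ _) _.
  rewrite Normc.normcM !normc_real /= expr0n expr1n add0r sqrtr1 mul1r.
  by rewrite mulr_natl mulr2n lerD.
have bnd (s t : R) : `|s| <= e -> `|t| <= r -> - (e * r) <= s * t.
  move=> se tr; have : `|s * t| <= e * r by rewrite normrM ler_pM.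
  by rewrite ler_norml => /andP[].
have h1 := bnd _ _ pu Rer; have h2 := bnd _ _ qv Imr.
have h3 := ler_wpM2r k0 nab.
have h4 : 0 < e * (r + k) by rewrite mulr_gt0.
lra.
Qed.

Section positive_operators.
Context d (X : measurableType d) (R : realType).
Variable mu : {measure set X -> \bar R}.
Implicit Types (f g h : L2 mu).

(** A real function [f] is the difference [|f| - (|f| - f)] of two nonnegative
ones, and the operator maps both to nonnegative functions. *)
Lemma positive_operator_real (B : {linear L2 mu -> L2 mu}) f :
  positive_operator B -> (\forall x \ae mu, complex.Im (f x) = 0) ->
  \forall x \ae mu, complex.Im (L2_to_fun (B f) x) = 0.
Proof.
move=> B0 fr; have [h hE] := L2_abs_exists f.
have h0 : L2_nonneg h.
  by apply: filterS hE => x ->; rewrite ler0c normc_ge0.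
have hf0 : L2_nonneg (h - f).
  apply: filterS3 (L2_funB h f) hE fr => x -> -> fx.
  rewrite subr_ge0 lecE/= fx eqxx/=.
  exact: le_trans (ler_norm _) (Re_le_normc _).
have := B0 _ hf0; rewrite linearB => Bhf0.
apply: filterS3 (L2_funB (B h) (B f)) (B0 _ h0) Bhf0 => x ->.
rewrite subr_ge0 !lecE => /andP[/eqP Bh _] /andP[/eqP Bhf _].
by rewrite -Bhf.
Qed.

(** With [f = u + 'i v], the real function [a u + b v] is at most
[|a + 'i b| |f|] pointwise by Cauchy-Schwarz in the plane; apply [B], which
commutes with real and imaginary parts. *)
Lemma positive_operator_rotation (B : {linear L2 mu -> L2 mu}) f h (a b : R) :
  positive_operator B ->
  (\forall x \ae mu, h x = (normc (f x))%:C%C) ->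
  \forall x \ae mu,
    a * complex.Re (L2_to_fun (B f) x) + b * complex.Im (L2_to_fun (B f) x) <=
    normc (Complex a b) * complex.Re (L2_to_fun (B h) x).
Proof.
move=> B0 hE.
have [u uE] := L2_Re_exists f; have [v vE] := L2_Im_exists f.
have fE : f = u + Complex 0 1 *: v.
  apply: L2_ext; near=> x.
  have -> : L2_to_fun (u + Complex 0 1 *: v) x = u x + L2_to_fun (Complex 0 1 *: v) x.
    by near: x; exact: L2_funD.
  have -> : L2_to_fun (Complex 0 1 *: v) x = Complex 0 1 * v x.
    by near: x; exact: L2_funZ.
  rewrite (near uE x)// (near vE x)//.
  case: (f x) => s t; apply/eqP; rewrite eq_complex/=.
  by apply/andP; split; apply/eqP; ring.
have Bu : \forall x \ae mu, complex.Im (L2_to_fun (B u) x) = 0.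
  by apply: positive_operator_real => //; apply: filterS uE => x ->.
have Bv : \forall x \ae mu, complex.Im (L2_to_fun (B v) x) = 0.
  by apply: positive_operator_real => //; apply: filterS vE => x ->.
pose n := normc (Complex a b).
have w0 : L2_nonneg (n%:C%C *: h - (a%:C%C *: u + b%:C%C *: v)).
  near=> x.
  have -> : L2_to_fun (n%:C%C *: h - (a%:C%C *: u + b%:C%C *: v)) x =
      L2_to_fun (n%:C%C *: h) x - L2_to_fun (a%:C%C *: u + b%:C%C *: v) x.
    by near: x; exact: L2_funB.
  have -> : L2_to_fun (a%:C%C *: u + b%:C%C *: v) x =
      L2_to_fun (a%:C%C *: u) x + L2_to_fun (b%:C%C *: v) x.
    by near: x; exact: L2_funD.
  have -> : L2_to_fun (n%:C%C *: h) x = n%:C%C * h x by near: x; exact: L2_funZ.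
  have -> : L2_to_fun (a%:C%C *: u) x = a%:C%C * u x by near: x; exact: L2_funZ.
  have -> : L2_to_fun (b%:C%C *: v) x = b%:C%C * v x by near: x; exact: L2_funZ.
  rewrite (near hE x)// (near uE x)// (near vE x)//.
  rewrite -!rmorphM -rmorphD -rmorphB ler0c subr_ge0.
  have -> : a * complex.Re (f x) + b * complex.Im (f x) =
      complex.Re (Complex a (- b) * f x).
    by case: (f x) => s t /=; ring.
  apply: le_trans (ler_norm _) (le_trans (Re_le_normc _) _).
  by rewrite Normc.normcM /n /= sqrrN.
have := B0 _ w0; rewrite linearB linearD !linearZ /= => Bw0.
have BfE : B f = B u + Complex 0 1 *: B v by rewrite {1}fE linearD linearZ.
rewrite BfE; near=> x; have := near Bw0 x _.
have -> : L2_to_fun (n%:C%C *: B h - (a%:C%C *: B u + b%:C%C *: B v)) x =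
    L2_to_fun (n%:C%C *: B h) x - L2_to_fun (a%:C%C *: B u + b%:C%C *: B v) x.
  by near: x; exact: L2_funB.
have -> : L2_to_fun (a%:C%C *: B u + b%:C%C *: B v) x =
    L2_to_fun (a%:C%C *: B u) x + L2_to_fun (b%:C%C *: B v) x.
  by near: x; exact: L2_funD.
have -> : L2_to_fun (n%:C%C *: B h) x = n%:C%C * L2_to_fun (B h) x.
  by near: x; exact: L2_funZ.
have -> : L2_to_fun (a%:C%C *: B u) x = a%:C%C * L2_to_fun (B u) x.
  by near: x; exact: L2_funZ.
have -> : L2_to_fun (b%:C%C *: B v) x = b%:C%C * L2_to_fun (B v) x.
  by near: x; exact: L2_funZ.
have -> : L2_to_fun (B u + Complex 0 1 *: B v) x =
    L2_to_fun (B u) x + L2_to_fun (Complex 0 1 *: B v) x.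
  by near: x; exact: L2_funD.
have -> : L2_to_fun (Complex 0 1 *: B v) x = Complex 0 1 * L2_to_fun (B v) x.
  by near: x; exact: L2_funZ.
have := near Bu x _; have := near Bv x _.
case: (L2_to_fun (B u) x) => s s' /=; case: (L2_to_fun (B v) x) => t t' /=.
case: (L2_to_fun (B h) x) => e e' /=.
move=> -> // -> //; rewrite lecE /= => /(_ _)/andP[]// _.
rewrite -[X in _ <= X * _]/n; lra.
Unshelve. all: by end_near. Qed.

(** The rotated inequalities for all rational [(a, b)] hold simultaneously outside
one null set, and there they give the inequality for the modulus. *)
Lemma positive_operator_abs (B : {linear L2 mu -> L2 mu}) f h :
  positive_operator B ->
  (\forall x \ae mu, h x = (normc (f x))%:C%C) ->
  \forall x \ae mu, (normc (L2_to_fun (B f) x))%:C%C <= L2_to_fun (B h) x.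
Proof.
move=> B0 hE.
have Bh0 : L2_nonneg (B h).
  by apply: B0; apply: filterS hE => x ->; rewrite ler0c normc_ge0.
pose P n x := if unpickle n is Some (p, q) then
  ratr p * complex.Re (L2_to_fun (B f) x) +
  ratr q * complex.Im (L2_to_fun (B f) x) <=
  normc (Complex (ratr p) (ratr q)) * complex.Re (L2_to_fun (B h) x) else true.
have : \forall x \ae mu, forall n, P n x.
  apply: ae_foralln => n; rewrite /P.
  case: (unpickle n : option (rat * rat)) => [[p q]|]; last exact: nearW.
  exact: positive_operator_rotation.
apply: filterS2 Bh0 => x; rewrite !lecE => /andP[/= /eqP -> Bh0] HP.
rewrite eqxx/=; apply: normc_le_of_rational => // p q.
by have := HP (pickle (p, q)); rewrite /P pickleK.
Qed.

(** Both inequalities of [|<B f, f>| <= <|B f|, |f|> <= <B |f|, |f|>] are between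
real numbers, so the conclusion is an inequality in the order of [R[i]]. *)
Lemma normc_L2_inner_positive (B : {linear L2 mu -> L2 mu}) f h :
  positive_operator B ->
  (\forall x \ae mu, h x = (normc (f x))%:C%C) ->
  (normc (L2_inner (B f) f))%:C%C <= L2_inner (B h) h.
Proof.
move=> B0 hE; have [g gE] := L2_abs_exists (B f).
apply: le_trans (normc_L2_inner_le_abs gE hE) _.
rewrite -subr_ge0 -L2_innerB; apply: L2_inner_ge0; last first.
  by apply: filterS hE => x ->; rewrite ler0c normc_ge0.
apply: filterS3 (L2_funB (B h) g) gE (positive_operator_abs B0 hE) => x -> ->.
by rewrite subr_ge0.
Qed.

End positive_operators.

(** * Numerical radius of positive operators *)

Section numerical_radius.
Context d (X : measurableType d) (R : realType).
Variable mu : {measure set X -> \bar R}.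
Implicit Types (f g h : L2 mu).

Lemma L2_norm_abs f h :
  (\forall x \ae mu, h x = (normc (f x))%:C%C) -> L2_norm h = L2_norm f.
Proof.
move=> hE; rewrite !L2_normE; congr Num.sqrt; apply: ae_eq_Rintegral.
- exact/measurable_EFinP/(measurable_int _ (integrable_sqr_normc h)).
- exact/measurable_EFinP/(measurable_int _ (integrable_sqr_normc f)).
- by apply: filterS hE => x ->; rewrite normc_real ger0_norm// normc_ge0.
Qed.

Lemma L2_bounded_ge0 (C : L2 mu -> L2 mu) : L2_bounded C ->
  exists2 M : R, 0 <= M & forall f, L2_norm (C f) <= M * L2_norm f.
Proof.
move=> [M CM]; exists `|M| => // f.
by apply: le_trans (CM f) _; rewrite ler_wpM2r ?L2_norm_ge0 ?ler_norm.
Qed.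

Lemma L2_bounded_comp (C E : L2 mu -> L2 mu) :
  L2_bounded C -> L2_bounded E -> L2_bounded (C \o E).
Proof.
move=> /L2_bounded_ge0[M M0 CM] [N EN]; exists (M * N) => f.
by apply: le_trans (CM _) _; rewrite -mulrA ler_wpM2l.
Qed.

(** Boundedness is what makes the supremum an upper bound: the supremum of an
unbounded set of reals is [0] by convention. *)
Lemma numerical_radius_ge (C : L2 mu -> L2 mu) f : L2_bounded C ->
  L2_norm f = 1 -> normc (L2_inner (C f) f) <= numerical_radius C.
Proof.
move=> /L2_bounded_ge0[M M0 CM] f1; apply: ub_le_sup; last by exists f.
exists (2^-1 * (M ^+ 2 + 1)) => _ [g g1 <-].
apply: le_trans (normc_L2_inner_bound _ _) _.
rewrite g1 expr1n ler_pM2l ?invr_gt0// lerD2r ler_pXn2r ?nnegrE ?L2_norm_ge0//.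
by rewrite -[M]mulr1 -g1.
Qed.

Lemma numerical_radius_ge0 (C : L2 mu -> L2 mu) :
  L2_bounded C -> 0 <= numerical_radius C.
Proof.
move=> bC; have [[f f1]|nf] := pselect (exists f : L2 mu, L2_norm f = 1).
  exact: le_trans (normc_ge0 _) (numerical_radius_ge bC f1).
rewrite /numerical_radius (_ : mkset _ = set0) ?image_set0 ?sup0//.
by rewrite -subset0 => f f1; apply: nf; exists f.
Qed.

(** Evaluate the hypothesis at [h = |f|] for a unit vector [f] and pair it with
[h]: then [k |<B f, f>| <= k <B h, h> <= \sum_i t i <C i h, h>], where [h] is again
a unit vector. *)
Lemma numerical_radius_weighted_le n (B : {linear L2 mu -> L2 mu})
    (C : 'I_n -> L2 mu -> L2 mu) (t : 'I_n -> R) (k : R) :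
  positive_operator B -> (forall i, L2_bounded (C i)) ->
  (forall i, 0 <= t i) -> 0 <= k ->
  (forall h, L2_nonneg h ->
     L2_nonneg (\sum_i (t i)%:C%C *: C i h - k%:C%C *: B h)) ->
  k * numerical_radius B <= \sum_i t i * numerical_radius (C i).
Proof.
move=> B0 bC t0 k0 BC; set S := \sum_i _.
have S0 : 0 <= S.
  by apply: sumr_ge0 => i _; rewrite mulr_ge0// numerical_radius_ge0.
have kS f : L2_norm f = 1 -> k * normc (L2_inner (B f) f) <= S.
  move=> f1; have [h hE] := L2_abs_exists f.
  have h0 : L2_nonneg h.
    by apply: filterS hE => x ->; rewrite ler0c normc_ge0.
  have h1 : L2_norm h = 1 by rewrite (L2_norm_abs hE).
  rewrite -lecR rmorphM.
  apply: le_trans (_ : k%:C%C * L2_inner (B h) h <= _).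
    by rewrite ler_wpM2l ?ler0c// normc_L2_inner_positive.
  have := L2_inner_ge0 (BC h h0) h0; rewrite L2_innerB subr_ge0 L2_innerZ.
  move=> kB.
  have z0 : 0 <= L2_inner (\sum_i (t i)%:C%C *: C i h) h.
    by apply: le_trans (kB); rewrite mulr_ge0 ?ler0c// L2_inner_ge0//; exact: B0.
  apply: le_trans kB _; rewrite -[leLHS](ger0_norm z0) L2_inner_sum.
  apply: le_trans (ler_norm_sum _ _ _) _; rewrite /S rmorph_sum.
  apply: ler_sum => i _; rewrite L2_innerZ normrM -!Defs.normcE -rmorphM lecR.
  by rewrite normc_real ger0_norm// ler_wpM2l// numerical_radius_ge.
have [->|kn0] := eqVneq k 0; first by rewrite mul0r.
have {kn0}k0' : 0 < k by rewrite lt_def kn0.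
rewrite mulrC -ler_pdivlMr//.
have [[f f1]|nf] := pselect (exists f : L2 mu, L2_norm f = 1).
  apply: ge_sup; first by exists (normc (L2_inner (B f) f)), f.
  by move=> _ [g g1 <-]; rewrite ler_pdivlMr// mulrC kS.
rewrite /numerical_radius (_ : mkset _ = set0) ?image_set0 ?sup0 ?divr_ge0//.
by rewrite -subset0 => f f1; apply: nf; exists f.
Qed.

End numerical_radius.

(** * Multiplication operators *)

Section multiplication_operators.
Context d (X : measurableType d) (R : realType).
Variable mu : {measure set X -> \bar R}.
Implicit Types (f g h : L2 mu).

Lemma multiplication_operator_bounded (D : L2 mu -> L2 mu) :
  multiplication_operator D -> L2_bounded D.
Proof.
move=> [phi /set_mem[mphi]]; rewrite /finite_norm unlock/= => phioo Dphi.
have [k kphi] : exists k, \forall x \ae mu, normc (phi x) <= k.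
  move: phioo; case: ifPn => [mu0|mu0 _].
    have -> : (abse \o (EFin \o (fun x => normc (phi x))))%E =
        EFin \o (fun x => normc (phi x)).
      by apply/funext => x /=; rewrite ger0_norm// normc_ge0.
    exact: ess_supr_bounded.
  (* The essential supremum is defined to be [0] for the zero measure, for which
     every property holds almost everywhere. *)
  exists 0, setT; split => //.
  by apply/eqP; rewrite eq_le measure_ge0 leNgt mu0.
exists `|k| => f; apply: L2_norm_le_ae => //.
apply: filterS2 (Dphi f) kphi => x -> kx.
by rewrite Normc.normcM ler_wpM2r ?normc_ge0// (le_trans kx)// ler_norm.
Qed.

(** Only the values of the multipliers on the set where [h > 0] matter. There,
positivity of [D i h] gives [phi i >= 0] and the hypothesis on the product gives
[\prod_i phi i >= 1], so the weighted mean inequality applies pointwise. *)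
Lemma multiplication_operator_weighted_sum n (D : 'I_n -> L2 mu -> L2 mu)
    (t : 'I_n -> R) (c : R) h : (0 < n)%N ->
  (forall i, multiplication_operator (D i)) ->
  (forall i, positive_operator (D i)) ->
  operator_ge (\big[comp/idfun]_(i < n) D i) idfun ->
  (forall i, 0 <= t i) -> 0 <= c -> c ^+ n <= \prod_i t i ->
  L2_nonneg h ->
  L2_nonneg (\sum_i (t i)%:C%C *: D i h - (n%:R * c)%:C%C *: h).
Proof.
move=> n0 Dm D0 Dprod t0 c0 ct h0.
have /choice[phi phiE] : forall i, exists phi : X -> R[i],
    forall f, \forall x \ae mu, D i f x = phi x * f x.
  by move=> i; have [phi _ ?] := Dm i; exists phi.
have prodE (s : seq 'I_n) : \forall x \ae mu,
    L2_to_fun ((\big[comp/idfun]_(i <- s) D i) h) x = (\prod_(i <- s) phi i x) * h x.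
  elim: s => [|i s IH].
    by rewrite big_nil; apply: nearW => x; rewrite big_nil mul1r.
  rewrite big_cons; apply: filterS2 (phiE i ((\big[comp/idfun]_(j <- s) D j) h)) IH.
  move=> x /= -> ->.
  by rewrite big_cons mulrA.
have Dh0 : \forall x \ae mu, forall i, 0 <= D i h x.
  by apply: filter_forall => i; exact: D0.
have DhE : \forall x \ae mu, forall i, D i h x = phi i x * h x.
  by apply: filter_forall => i; exact: phiE.
have scE : \forall x \ae mu, forall i,
    L2_to_fun ((t i)%:C%C *: D i h) x = (t i)%:C%C * D i h x.
  by apply: filter_forall => i; exact: L2_funZ.
have := Dprod h h0; set Ph := (\big[comp/idfun]_(i < n) D i) h => Dprodh.
near=> x.
have -> : L2_to_fun (\sum_i (t i)%:C%C *: D i h - (n%:R * c)%:C%C *: h) x =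
    L2_to_fun (\sum_i (t i)%:C%C *: D i h) x - L2_to_fun ((n%:R * c)%:C%C *: h) x.
  by near: x; exact: L2_funB.
have -> : L2_to_fun (\sum_i (t i)%:C%C *: D i h) x =
    \sum_i L2_to_fun ((t i)%:C%C *: D i h) x by near: x; exact: L2_fun_sum.
have -> : L2_to_fun ((n%:R * c)%:C%C *: h) x = (n%:R * c)%:C%C * h x.
  by near: x; exact: L2_funZ.
have hx0 : 0 <= h x by near: x.
have Dhx : forall i, 0 <= phi i x * h x.
  by move=> i; rewrite -(near DhE x)// (near Dh0 x).
have : 0 <= \prod_i phi i x * h x - h x.
  have <- : Ph x = \prod_i phi i x * h x by near: x; exact: prodE.
  have <- : L2_to_fun (Ph - h) x = Ph x - h x by near: x; exact: L2_funB.
  exact: (near Dprodh x).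
have -> : \sum_i L2_to_fun ((t i)%:C%C *: D i h) x =
    \sum_i (t i)%:C%C * phi i x * h x.
  by apply: eq_bigr => i _; rewrite (near scE x)// (near DhE x)// mulrA.
rewrite -mulr_suml -mulrBl -[X in _ - X]mul1r -mulrBl.
have [->|hn0] := eqVneq (h x) 0; first by rewrite !mulr0.
have {hn0}hx : 0 < h x by rewrite lt_def hn0.
rewrite !pmulr_lge0// !subr_ge0 => prod1.
have phi0 i : 0 <= phi i x by have := Dhx i; rewrite pmulr_lge0.
rewrite rmorphM rmorph_nat; apply: weighted_AGM => //.
- by move=> i; rewrite ler0c.
- by rewrite ler0c.
- by rewrite -rmorphXn -rmorph_prod lecR.
Unshelve. all: by end_near. Qed.

End multiplication_operators.

(** * Product bound for the numerical radius *)

Theorem theorem2p3 (d : measure_display) (X : measurableType d) (R : realType)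
    (mu : {sigma_finite_measure set X -> \bar R})
    (m : nat) (hm : (1 <= m)%N)
    (D : 'I_m -> {linear L2 mu -> L2 mu})
    (D_mult : forall i, multiplication_operator (D i))
    (D_pos : forall i, positive_operator (D i))
    (D_prod : operator_ge (\big[comp/idfun]_(i < m) D i) idfun)
    (A : {linear L2 mu -> L2 mu})
    (A_bounded : L2_bounded A) (A_pos : positive_operator A) :
  numerical_radius A ^+ m <= \prod_(i < m) numerical_radius (D i \o A) /\
  numerical_radius A ^+ m <= \prod_(i < m) numerical_radius (A \o D i).
Proof.
have D_bounded i := multiplication_operator_bounded (D_mult i).
split; apply: prod_bound_of_weighted_sums => //.
- exact: numerical_radius_ge0.
- by move=> i; apply: numerical_radius_ge0; exact: L2_bounded_comp.
- move=> t c t0 c0 ct.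
  apply: (numerical_radius_weighted_le (C := fun i => D i \o A)) => //.
  + by move=> i; exact: L2_bounded_comp.
  + by rewrite mulr_ge0.
  + move=> h h0; exact: (multiplication_operator_weighted_sum hm D_mult D_pos D_prod
      t0 c0 ct (A_pos _ h0)).
- exact: numerical_radius_ge0.
- by move=> i; apply: numerical_radius_ge0; exact: L2_bounded_comp.
- move=> t c t0 c0 ct.
  apply: (numerical_radius_weighted_le (C := fun i => A \o D i)) => //.
  + by move=> i; exact: L2_bounded_comp.
  + by rewrite mulr_ge0.
  + move=> h h0.
    have := A_pos _ (multiplication_operator_weighted_sum hm D_mult D_pos D_prod
      t0 c0 ct h0).
    rewrite linearB linearZ linear_sum.
    by under eq_bigr do rewrite linearZ.
Qed.
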